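(* Let $G=(V,w,m)$ be an infinite, connected, normalized linear graph satisfying $\mathrm{CD}(0,D)$ for some $D<\infty$. Then $G$ satisfies the Poincaré inequality $P(16)$, i.e. for all $x_0\in V$, all $R>0$ and all $f:V\to\mathbb{R}$, $$\sum_{x\in B_R(x_0)}m(x)(f(x)-f_B)^2\le 16R^2\sum_{x,y\in B_{2R}(x_0)}w(x,y)(f(x)-f(y))^2,$$ where $f_B=\frac1{m(B_R(x_0))}\sum_{x\in B_R(x_0)}f(x)m(x)$.
   Context: A weighted graph $G=(V,E,w,m)$ is a connected, undirected, simple, locally finite graph $(V,E)$ with vertex weights $m:V\to(0,\infty)$ and symmetric edge weights $w:E\to(0,\infty)$, $w(x,y)=w(y,x)$ (with $w(x,y)=0$ if $x\not\sim y$). It is normalized if $m(x)=\sum_{y\sim x}w(x,y)$ for all $x\in V$. It is a linear graph if $V=\mathbb{Z}\cap I$ for a (bounded or unbounded) interval $I\subset\mathbb{R}$ and $E=\{\{n,n+1\}: n,n+1\in V\}$. $B_R(x)=\{y\in V:d(x,y)\le R\}$ is the ball with respect to the combinatorial graph distance $d$, and $m(A)=\sum_{x\in A}m(x)$. The sum over $x,y\in B_{2R}(x_0)$ runs over ordered pairs. The Laplacian is $\Delta f(x)=\frac1{m(x)}\sum_{y\sim x}w(x,y)(f(y)-f(x))$ for $f:V\to\mathbb{R}$. Set $\Gamma(f,g)=\frac12(\Delta(fg)-f\Delta g-g\Delta f)$, $\Gamma(f)=\Gamma(f,f)$, and $\Gamma_2(f)=\frac12\Delta\Gamma(f)-\Gamma(f,\Delta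 f)$. For $K\in\mathbb{R}$, $D\in(0,\infty]$ (with $1/\infty=0$) and $x\in V$, the condition $\mathrm{CD}(K,D,x)$ means $\Gamma_2(f)(x)\ge\frac1D(\Delta f(x))^2+K\,\Gamma(f)(x)$ for all $f:V\to\mathbb{R}$; $\mathrm{CD}(K,D)$ means that $\mathrm{CD}(K,D,x)$ holds for all $x\in V$. *)

(* Defs.v *)
From HB Require Import structures.
From mathcomp Require Import all_boot all_order all_algebra.
From mathcomp Require Import all_classical all_reals.

Set Implicit Arguments.
Unset Strict Implicit.
Unset Printing Implicit Defensive.

Import Order.TTheory GRing.Theory Num.Theory.
Local Open Scope classical_set_scope.
Local Open Scope ring_scope.

Record weightedGraph (R : realType) (V : choiceType) := WeightedGraph {
  adj : rel V;
  edge_weight : V -> V -> R;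
  vertex_weight : V -> R;
  adj_sym : symmetric adj;
  adj_irr : irreflexive adj;
  adj_locally_finite : forall x, finite_set [set y | adj x y];
  adj_connected : forall x y, exists p : seq V, path adj x p /\ last x p = y;
  edge_weight_sym : forall x y, edge_weight x y = edge_weight y x;
  edge_weight_gt0 : forall x y, adj x y -> 0 < edge_weight x y;
  edge_weight_eq0 : forall x y, ~~ adj x y -> edge_weight x y = 0;
  vertex_weight_gt0 : forall x, 0 < vertex_weight x
}.

Section Graph.
Variables (R : realType) (V : choiceType) (G : weightedGraph R V).
Implicit Types (x y : V) (f g : V -> R).

Local Notation w := (edge_weight G).
Local Notation m := (vertex_weight G).

(* The sums [\sum_(_ \in A) _] below are the library's finitely supported sums,
   with value 0 by convention on an infinite support. That convention is never
   used: neighbourhoods, and hence balls, are finite. *)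

Definition nbrs x : set V := [set y | adj G x y].

Definition walk_length x y (n : nat) : Prop :=
  exists p : seq V, [/\ path (adj G) x p, last x p = y & size p = n].

Lemma ex_walk_length x y : exists n, `[< walk_length x y n >].
Proof.
by have [p [xp py]] := adj_connected G x y; exists (size p); apply/asboolP; exists p.
Qed.

Definition graph_dist x y : nat := ex_minn (ex_walk_length x y).

Definition graph_ball (r : R) x : set V := [set y | (graph_dist x y)%:R <= r].

Definition graph_measure (A : set V) : R := \sum_(x \in A) m x.

Definition normalized : Prop := forall x, m x = \sum_(y \in nbrs x) w x y.

Definition laplacian f : V -> R :=
  fun x => (m x)^-1 * \sum_(y \in nbrs x) w x y * (f y - f x).

Definition Gamma f g : V -> R := fun x =>
  2^-1 * (laplacian (fun z => f z * g z) x - f x * laplacian g x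
          - g x * laplacian f x).

Definition Gamma2 f : V -> R := fun x =>
  2^-1 * laplacian (Gamma f f) x - Gamma f (laplacian f) x.

(* [fine D^-1] is 1/D for 0 < D < +oo and 0 for D = +oo. *)
Definition CD_at (K : R) (D : \bar R) x : Prop :=
  forall f, fine (D^-1)%E * laplacian f x ^+ 2 + K * Gamma f f x <= Gamma2 f x.

Definition CD (K : R) (D : \bar R) : Prop := forall x, CD_at K D x.

Definition ball_average f (B : set V) : R :=
  (graph_measure B)^-1 * \sum_(x \in B) f x * m x.

Definition poincare (C : R) : Prop := forall (x0 : V) (r : R) f, 0 < r ->
  \sum_(x \in graph_ball r x0) m x * (f x - ball_average f (graph_ball r x0)) ^+ 2
  <= C * r ^+ 2 *
     \sum_(p \in graph_ball (2 * r) x0 `*` graph_ball (2 * r) x0)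
        w p.1 p.2 * (f p.1 - f p.2) ^+ 2.

End Graph.

Definition linear_graph (R : realType) (I : interval R)
    (G : weightedGraph R {n : int | n%:~R \in I}) : Prop :=
  forall x y, adj G x y = (val y == val x + 1) || (val x == val y + 1).

(* Main.v *)
(* Write p n, q n for the probabilities of stepping right and left from n. Testing
   Gamma2 >= 0 at n on functions that are linear on either side of n gives
     p n (2 q (n+1) - q n) a^2 + q n (2 p (n-1) - p n) b^2 - 2 (p n) (q n) a b >= 0.
   The harmonic choice a = q n, b = p n yields
     q n * q (n+1) + p n * p (n-1) >= 1/2 >= 2 (p n) (q n),
   which forces the vertex weight to be unimodal; b = 0 yields q n <= 2 q (n+1),
   hence w n (n+1) >= m (n+1) / 4 wherever m does not increase from n to n+1. So if
   x1 maximises m on the ball, m x <= 4 w e for every edge e between x1 and x, and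
   Cauchy-Schwarz along the segment from x1 to x bounds m x (f x - f x1)^2 by
   4 |x - x1| <= 8 r times the energy. The ball has at most 2 r points besides x1,
   and the average of f minimises the quadratic deviation. *)
Require Import Defs.
From HB Require Import structures.
From mathcomp Require Import all_boot all_order all_algebra.
From mathcomp Require Import all_classical all_reals.
From mathcomp Require Import finmap ring lra zify.

Set Implicit Arguments.
Unset Strict Implicit.
Unset Printing Implicit Defensive.

Import Order.TTheory GRing.Theory Num.Theory.
Local Open Scope classical_set_scope.
Local Open Scope ring_scope.

(** * Cauchy-Schwarz for telescoping sums *)

Lemma sqr_telescope_le (R : realFieldType) (u : nat -> R) k :
  (u k - u 0%N) ^+ 2 <= k%:R * \sum_(i < k) (u i - u i.+1) ^+ 2.
Proof.
elim: k => [|k IH]; first by rewrite subrr expr0n /= mul0r.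
rewrite big_ord_recr /=; set Q := \sum_(i < k) _ in IH *.
have Q0 : 0 <= Q by apply: sumr_ge0 => i _; exact: sqr_ge0.
have -> : (u k.+1 - u 0%N) = (u k - u 0%N) - (u k - u k.+1) by ring.
move: IH; set a := u k - u 0%N; set d := u k - u k.+1 => IH.
case: k @Q Q0 @a @d IH => [|k] Q Q0 a d.
  by rewrite /a subrr sub0r sqrrN mul1r lerDr Q0.
rewrite -[k.+2]addn1 natrD; set K : R := k.+1%:R => IH.
have K0 : 0 < K by rewrite ltr0n.
(* This square is the gap in Young's inequality K (a - d)^2 <= (K + 1) a^2 + K (K + 1) d^2. *)
have := sqr_ge0 (a + K * d).
have : (K + 1) * a ^+ 2 <= (K + 1) * (K * Q) by rewrite ler_pM2l // addr_gt0.
move=> h1 h2; rewrite -(ler_pM2l K0); lra.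
Qed.

(** * Curvature and Poincaré estimate on a segment of the weighted integer line *)

Section IntegerLine.
Variables (R : realType) (W : int -> int -> R).
Hypothesis W_ge0 : forall a b, 0 <= W a b.
Hypothesis W_sym : forall a b, W a b = W b a.
Implicit Types (F H : int -> R) (n s : int).

Definition line_weight n : R := W n (n + 1) + W n (n - 1).

(** Where [line_weight n] vanishes, as it does off the vertices of a graph, both step probabilities
    are 0 and do not add up to 1. *)
Definition step_prob n s : R := (line_weight n)^-1 * W n (n + s).

Definition line_laplacian F n : R :=
  step_prob n 1 * (F (n + 1) - F n) + step_prob n (-1) * (F (n - 1) - F n).

Definition line_Gamma F H n : R :=
  2^-1 * (line_laplacian (fun z => F z * H z) n - F n * line_laplacian H n
          - H n * line_laplacian F n).

Definition line_Gamma2 F n : R :=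
  2^-1 * line_laplacian (line_Gamma F F) n - line_Gamma F (line_laplacian F) n.

Local Notation M := line_weight.
Local Notation P := step_prob.

(** The sign handles left and right at once, so that one argument serves on both sides of the
    maximum of the weight. *)
Definition direction s := s = 1 \/ s = -1.

Lemma directionN s : direction s -> direction (- s).
Proof. by case=> ->; [right|left; rewrite opprK]. Qed.

Lemma line_weight_dir n s : direction s -> M n = W n (n + s) + W n (n - s).
Proof. by case=> ->; rewrite /line_weight ?opprK // addrC. Qed.

Lemma line_laplacian_dir F n s : direction s ->
  line_laplacian F n = P n s * (F (n + s) - F n) + P n (- s) * (F (n - s) - F n).
Proof. by case=> ->; rewrite /line_laplacian ?opprK // addrC. Qed.

Lemma step_prob_ge0 n s : 0 <= P n s.
Proof. by rewrite mulr_ge0 // invr_ge0 addr_ge0. Qed.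

Lemma step_probD n s : direction s -> 0 < M n -> P n s + P n (- s) = 1.
Proof.
by move=> ds Mn; rewrite -mulrDr -line_weight_dir // mulVf // gt_eqF.
Qed.

Lemma line_weight_gt0 n s : direction s -> 0 < W n (n + s) -> 0 < M n.
Proof. by move=> ds Wn; rewrite (line_weight_dir _ ds) ltr_wpDr. Qed.

Lemma step_prob_gt0 n s : direction s -> (0 < P n s) = (0 < W n (n + s)).
Proof.
move=> ds; apply/idP/idP => [|Wn]; last first.
  by rewrite mulr_gt0 // invr_gt0 (line_weight_gt0 ds).
rewrite /step_prob; have := W_ge0 n (n + s); rewrite le_eqVlt => /predU1P[<-|//].
by rewrite mulr0 ltxx.
Qed.

(* Extending the slopes at [n] linearly minimises [line_Gamma2] at [n] among all
   functions with given values at the neighbours of [n]. *)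
Definition bent n s (a b : R) : int -> R :=
  fun z => let t := s * (z - n) in (if 0 <= t then a else b) * t%:~R.

Lemma line_Gamma2_bent n s a b : direction s -> 0 < M n ->
  2 * line_Gamma2 (bent n s a b) n =
  P n s * (2 * P (n + s) (- s) - P n (- s)) * a ^+ 2
  + P n (- s) * (2 * P (n - s) s - P n s) * b ^+ 2
  - 2 * P n s * P n (- s) * a * b.
Proof.
move=> ds Mn.
have F0 : bent n s a b n = 0 by rewrite /bent subrr mulr0 mulr0.
have F1 : bent n s a b (n + s) = a.
  by rewrite /bent; case: ds => ->; rewrite addrC addKr ?mulr1 ?mulrNN ?mulr1.
have F2 : bent n s a b (n + s + s) = 2 * a.
  rewrite /bent.
  have -> : s * (n + s + s - n) = 2 by case: ds => ->; ring.
  by rewrite mulrC.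
have F1' : bent n s a b (n - s) = - b.
  rewrite /bent.
  have -> : s * (n - s - n) = -1 by case: ds => ->; ring.
  by rewrite /= mulrN1.
have F2' : bent n s a b (n - s - s) = - 2 * b.
  rewrite /bent.
  have -> : s * (n - s - s - n) = - 2 by case: ds => ->; ring.
  by rewrite mulrC.
rewrite /line_Gamma2 /line_Gamma !(line_laplacian_dir _ _ ds).
rewrite !addrK !subrK F0 F1 F2 F1' F2'.
have e1 := step_probD ds Mn.
(* The probabilities at [n + s] add up to 1 only if its weight is positive. This holds when [P n s]
   is positive; otherwise both sides vanish. *)
have e2 : P n s * P (n + s) s = P n s - P n s * P (n + s) (- s).
  have := step_prob_ge0 n s; rewrite le_eqVlt => /predU1P[<-|]; first by ring.
  rewrite step_prob_gt0 // => Wn.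
  have /(step_probD ds) e : 0 < M (n + s).
    by apply: (line_weight_gt0 (directionN ds)); rewrite addrK W_sym.
  by rewrite -[X in _ = X - _]mulr1 -e; ring.
have e3 : P n (- s) * P (n - s) (- s) = P n (- s) - P n (- s) * P (n - s) s.
  have := step_prob_ge0 n (- s); rewrite le_eqVlt => /predU1P[<-|]; first by ring.
  rewrite (step_prob_gt0 _ (directionN ds)) => Wn.
  have /(step_probD ds) e : 0 < M (n - s).
    by apply: (line_weight_gt0 ds); rewrite subrK W_sym.
  by rewrite -[X in _ = X - _]mulr1 -e; ring.
move: e1 e2 e3.
move: (P n s) (P n (- s)) (P (n + s) s) (P (n + s) (- s)).
move: (P (n - s) s) (P (n - s) (- s)).
move=> pm qm p q pp qp e1 e2 e3.
(* [field] uses equations as rewriting rules for monomials, so p + q = 1 is supplied in the form of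
   rules for the squares. *)
have e4 : p * p = p - p * q by rewrite -[X in _ = X - _]mulr1 -e1; ring.
have e5 : q * q = q - p * q by rewrite -[X in _ = X - _]mulr1 -e1; ring.
by field: e2 e3 e4 e5.
Qed.

Hypothesis Gamma2_ge0 : forall F n, 0 < M n -> 0 <= line_Gamma2 F n.

Lemma step_prob_back_ge n s : direction s -> 0 < W n (n + s) ->
  P n (- s) <= 2 * P (n + s) (- s).
Proof.
move=> ds Wn; have Mn := line_weight_gt0 ds Wn.
(* Slope 0 behind [n] leaves only the coefficient of a^2, so the edge behind [n] may be absent. *)
have := Gamma2_ge0 (bent n s 1 0) Mn.
rewrite -(pmulr_rge0 _ (ltr0Sn R 1)) line_Gamma2_bent //.
rewrite expr1n expr0n !mulr0 mulr1 addr0 subr0.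
by rewrite pmulr_rge0 ?step_prob_gt0 // subr_ge0.
Qed.

(* The slopes are chosen so that the test function is harmonic at [n]. *)
Lemma step_prob_harmonic n s : direction s ->
  0 < W n (n + s) -> 0 < W n (n - s) ->
  1 <= 2 * (P n (- s) * P (n + s) (- s) + P n s * P (n - s) s).
Proof.
move=> ds Wn Wn'; have Mn := line_weight_gt0 ds Wn.
have := Gamma2_ge0 (bent n s (P n (- s)) (P n s)) Mn.
rewrite -(pmulr_rge0 _ (ltr0Sn R 1)) line_Gamma2_bent //.
have p0 : 0 < P n s by rewrite step_prob_gt0.
have q0 : 0 < P n (- s) by rewrite step_prob_gt0 //; exact: directionN.
(* The two squares and the mixed term collect to -(p + q)^2, which is -1. *)
rewrite [X in 0 <= X](_ : _ = P n s * P n (- s) *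
  (2 * (P n (- s) * P (n + s) (- s) + P n s * P (n - s) s)
   - (P n s + P n (- s)) ^+ 2)); last by ring.
by rewrite (pmulr_rge0 _ (mulr_gt0 p0 q0)) (step_probD ds Mn) expr1n subr_ge0.
Qed.

(** A heavier neighbour uses the common edge with smaller probability. If [n + s] were strictly
    heavier than [n] and [n - s] at least as heavy, the harmonic bound would give 1 < 4 p q,
    contradicting p + q = 1. *)
Lemma line_weight_unimodal n s : direction s ->
  0 < W n (n + s) -> 0 < W n (n - s) ->
  M n <= M (n - s) -> M (n + s) <= M n.
Proof.
move=> ds Wn Wn' le_back; have Mn := line_weight_gt0 ds Wn.
have h := step_prob_harmonic ds Wn Wn'.
rewrite leNgt; apply/negP => lt_forth.
have Ep : P (n - s) s <= P n (- s).
  rewrite /step_prob subrK (W_sym (n - s)) ler_pM2r // lef_pV2 // posrE //.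
  exact: lt_le_trans le_back.
have Eq : P (n + s) (- s) < P n s.
  rewrite /step_prob addrK (W_sym (n + s)) ltr_pM2r // ltf_pV2 // posrE //.
  exact: lt_trans lt_forth.
have p0 : 0 < P n s by rewrite step_prob_gt0.
have q0 : 0 < P n (- s) by rewrite step_prob_gt0 //; exact: directionN.
have := step_probD ds Mn.
have : P n (- s) * P (n + s) (- s) < P n (- s) * P n s by rewrite ltr_pM2l.
have : P n s * P (n - s) s <= P n s * P n (- s) by rewrite ler_pM2l.
have : 0 <= (P n s - P n (- s)) ^+ 2 by exact: sqr_ge0.
move: h; set A := _ * P (n + s) _; set B := _ * P (n - s) _.
move=> {Ep Eq}; nra.
Qed.

Lemma line_weight_le_edge n s : direction s -> 0 < W n (n + s) ->
  M (n + s) <= M n -> M (n + s) <= 4 * W n (n + s).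
Proof.
move=> ds Wn leM; have Mn := line_weight_gt0 ds Wn.
have Mn' : 0 < M (n + s).
  by apply: (line_weight_gt0 (directionN ds)); rewrite addrK W_sym.
have back := step_prob_back_ge ds Wn.
have sum1 := step_probD ds Mn.
have EW : W n (n + s) = M n * P n s by rewrite mulVKf // gt_eqF.
have EW' : W n (n + s) = M (n + s) * P (n + s) (- s).
  by rewrite /step_prob addrK W_sym mulVKf // gt_eqF.
(* Either the edge carries at least half of [M n], or the backward probability at [n] exceeds 1/2,
   and then that at [n + s] exceeds 1/4. *)
have [le_half|gt_half] := leP 2^-1 (P n s).
  by rewrite EW; nra.
by rewrite EW'; nra.
Qed.

(** By unimodality a first non-increasing step propagates, so the far endpoint is the lightest point
    of the segment. Its weight is then at most 4 times that of every edge and can be moved inside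
    the telescoping bound. *)
Lemma line_poincare F n s k : direction s ->
  (forall i, (i < k)%N -> 0 < W (n + s *+ i) (n + s *+ i.+1)) ->
  M (n + s) <= M n ->
  M (n + s *+ k) * (F (n + s *+ k) - F n) ^+ 2 <=
  4 * k%:R * \sum_(i < k) W (n + s *+ i) (n + s *+ i.+1) *
                       (F (n + s *+ i) - F (n + s *+ i.+1)) ^+ 2.
Proof.
move=> ds Wk M1.
have step i : n + s *+ i.+1 = n + s *+ i + s by rewrite mulrSr addrA.
have Mdec i : (i < k)%N -> M (n + s *+ i.+1) <= M (n + s *+ i).
  elim: i => [|i IH] ik; first by rewrite mulr1n addr0.
  rewrite [in leLHS]step; apply: line_weight_unimodal => //.
  - by rewrite -step; exact: Wk.
  - by rewrite [in X in _ < W _ X]step addrK W_sym; apply: Wk; exact: ltnW.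
  - by rewrite [in leRHS]step addrK; apply: IH; exact: ltnW.
have Mlast i j : (i < j <= k)%N -> M (n + s *+ j) <= M (n + s *+ i.+1).
  elim: j => [//|j IH] /andP[]; rewrite ltnS leq_eqVlt => /predU1P[->//|ij] jk.
  by apply: le_trans (Mdec _ jk) (IH _); rewrite ij ltnW.
have M0 : 0 <= M (n + s *+ k) by exact: addr_ge0.
rewrite -sqrrN opprB.
have := sqr_telescope_le (fun i => F (n + s *+ i)) k.
rewrite mulr0n addr0 -[X in X <= _]sqrrN opprB => /(ler_wpM2l M0)/le_trans; apply.
rewrite mulrCA (mulrC 4) -mulrA ler_wpM2l ?ler0n // !mulr_sumr.
rewrite ler_sum // => -[i ik] _ /=.
rewrite mulrA ler_wpM2r ?sqr_ge0 //.
apply: le_trans (Mlast i _ _) _; first by rewrite ik leqnn.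
rewrite step; apply: line_weight_le_edge => //; first by rewrite -step; exact: Wk.
by rewrite -step; exact: Mdec.
Qed.

End IntegerLine.

(** * Maxima, subsums and variance over finite sequences *)

Lemma seq_argmax (R : realDomainType) (T : eqType) (h : T -> R) x (s : seq T) :
  x \in s -> exists2 y, y \in s & forall z, z \in s -> h z <= h y.
Proof.
elim: s x => [//|a [|b s] IH] x _.
  by exists a; rewrite ?mem_head // => z; rewrite inE => /eqP ->.
have [y ys ymax] := IH b (mem_head _ _).
have [le_ay|lt_ya] := leP (h a) (h y).
  exists y; first by rewrite in_cons ys orbT.
  by move=> z; rewrite in_cons => /predU1P[->|/ymax].
exists a; first exact: mem_head.
by move=> z; rewrite in_cons => /predU1P[->//|/ymax/le_trans]; apply; exact: ltW.
Qed.

Lemma ler_sum_subseq (R : numDomainType) (T : eqType) (h : T -> R) (s t : seq T) :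
  uniq s -> uniq t -> {subset t <= s} -> (forall z, 0 <= h z) ->
  \sum_(z <- t) h z <= \sum_(z <- s) h z.
Proof.
move=> us ut ts h0; rewrite [leRHS](bigID (mem t)) /= -[X in _ <= X + _]big_filter.
have e : perm_eq t [seq z <- s | z \in t].
  apply: uniq_perm; rewrite ?filter_uniq // => z.
  by rewrite mem_filter andb_idr // => /ts.
by rewrite (perm_big _ e) lerDl sumr_ge0.
Qed.

(** Moving the centre from the mean mu to c adds exactly (mu - c)^2 times the total mass. *)
Lemma variance_le (R : realFieldType) (T : Type) (s : seq T) (m f : T -> R) c :
  0 < \sum_(x <- s) m x ->
  \sum_(x <- s) m x * (f x - (\sum_(y <- s) m y)^-1 * \sum_(y <- s) f y * m y) ^+ 2
  <= \sum_(x <- s) m x * (f x - c) ^+ 2.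
Proof.
set A := \sum_(x <- s) m x; set B := \sum_(y <- s) f y * m y => A0.
set mu := A^-1 * B; rewrite -subr_ge0 -sumrB.
rewrite (eq_bigr (fun x =>
  (mu - c) * (2 * (f x * m x)) - (mu - c) * (mu + c) * m x)); last by move=> x _; ring.
rewrite sumrB -!mulr_sumr -/A -/B.
have -> : B = A * mu by rewrite mulVKf // gt_eqF.
rewrite (_ : _ - _ = (mu - c) ^+ 2 * A); last by ring.
by rewrite mulr_ge0 ?sqr_ge0 // ltW.
Qed.

(** * Transfer of a linear graph to the integer line *)

Section LinearGraph.
Variables (R : realType) (I : interval R).
Local Notation V := {n : int | n%:~R \in I}.
Variable G : weightedGraph R V.
Hypothesis linG : linear_graph G.
Implicit Types (x y z : V) (f g : V -> R) (F H : int -> R).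

Local Notation w := (edge_weight G).
Local Notation m := (vertex_weight G).

Definition pos x : int := val x.

Lemma pos_inj : injective pos. Proof. exact: val_inj. Qed.

Lemma insub_pos x : insub (pos x) = Some x :> option V. Proof. exact: valK. Qed.

Lemma pos_insubd x (a : int) : (a%:~R : R) \in I -> pos (insubd x a) = a.
Proof. by move=> aI; rewrite /pos val_insubd aI. Qed.

Lemma insubd_pos x y : insubd x (pos y) = y.
Proof. exact: valKd. Qed.

Lemma adj_pos x y : adj G x y = (pos y == pos x + 1) || (pos x == pos y + 1).
Proof. exact: linG. Qed.

(* Extending all data by 0 from the vertices to all of [int] turns sums over
   neighbours into unconditional two-term sums. *)
Definition line_fun f (a : int) : R := oapp f 0 (insub a).

Definition line_edge (a b : int) : R := line_fun (fun u => line_fun (w u) b) a.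

Lemma line_fun_val f x : line_fun f (pos x) = f x.
Proof. by rewrite /line_fun insub_pos. Qed.

Lemma line_edge_val x y : line_edge (pos x) (pos y) = w x y.
Proof. by rewrite /line_edge !line_fun_val. Qed.

Lemma edge_weight_ge0 x y : 0 <= w x y.
Proof.
by have [/(edge_weight_gt0 )/ltW|/(edge_weight_eq0) ->] := boolP (adj G x y).
Qed.

Lemma line_edge_ge0 a b : 0 <= line_edge a b.
Proof.
rewrite /line_edge /line_fun.
by case: (insub a) (insub b) => [u|] [v|] //=; exact: edge_weight_ge0.
Qed.

Lemma line_edge_sym a b : line_edge a b = line_edge b a.
Proof.
rewrite /line_edge /line_fun.
by case: (insub a) (insub b) => [u|] [v|] //=; exact: edge_weight_sym.
Qed.

(** The fibre has at most one point; when it is empty, the sum agrees with the default 0 of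
    [line_fun]. *)
Lemma fsbig_fiber g (a : int) :
  \sum_(y \in [set y | pos y = a]) g y = line_fun g a.
Proof.
rewrite /line_fun; case: insubP => [u _ ua|na] /=.
  rewrite (_ : [set y | _] = [set u]) ?fsbig_set1 //.
  apply/seteqP; split => y /=; last by move=> ->.
  by rewrite -ua => /val_inj.
rewrite (_ : [set y | _] = set0) ?fsbig_set0 //.
by apply/seteqP; split => y //= ya; move: na; rewrite -ya (valP y).
Qed.

Lemma sum_nbrs x g :
  \sum_(y \in nbrs G x) g y = line_fun g (pos x + 1) + line_fun g (pos x - 1).
Proof.
have -> : nbrs G x = [set y | pos y = pos x + 1] `|` [set y | pos y = pos x - 1].
  apply/seteqP; split => y /=; rewrite /nbrs /= adj_pos.
    by move=> /orP[/eqP|/eqP ->]; [left|right; rewrite addrK].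
  by move=> [e|e]; apply/orP; [left|right]; rewrite e ?subrK.
rewrite fsbigU /=.
- by rewrite !fsbig_fiber.
- apply: sub_finite_set (finite_seq (seq_of_opt (insub (pos x + 1)))) => y /= <-.
  by rewrite insub_pos /= mem_head.
- apply: sub_finite_set (finite_seq (seq_of_opt (insub (pos x - 1)))) => y /= <-.
  by rewrite insub_pos /= mem_head.
- by move=> y [/= ya yb]; exfalso; lia.
Qed.

Hypothesis normG : normalized G.

Lemma vertex_weight_line x : m x = line_weight line_edge (pos x).
Proof. by rewrite normG sum_nbrs /line_weight /line_edge !line_fun_val. Qed.

(** Restrictions [F \o pos] are stable under the operators, so the identity can be iterated up to
    [Gamma2]. Values of [F] off the vertices meet zero edge weights. *)
Lemma laplacian_line F :
  laplacian G (F \o pos) = line_laplacian line_edge F \o pos.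
Proof.
apply/funext => x; rewrite /laplacian sum_nbrs /line_laplacian /step_prob /=.
rewrite -vertex_weight_line mulrDr -!mulrA; congr (_ * _ + _ * _).
- rewrite [in RHS]/line_edge line_fun_val /line_fun.
  by case: insubP => [u _ <-|_] //=; rewrite mul0r.
- rewrite [in RHS]/line_edge line_fun_val /line_fun.
  by case: insubP => [u _ <-|_] //=; rewrite mul0r.
Qed.

Lemma Gamma_line F H :
  Gamma G (F \o pos) (H \o pos) = line_Gamma line_edge F H \o pos.
Proof.
apply/funext => x; rewrite /Gamma !laplacian_line.
by rewrite (laplacian_line (fun a => F a * H a)).
Qed.

Lemma Gamma2_line F :
  Gamma2 G (F \o pos) = line_Gamma2 line_edge F \o pos.
Proof.
by apply/funext => x; rewrite /Gamma2 Gamma_line !laplacian_line Gamma_line.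
Qed.

Lemma line_Gamma2_ge0 (D : \bar R) : (0 < D)%E -> CD G 0 D ->
  forall F n, 0 < line_weight line_edge n -> 0 <= line_Gamma2 line_edge F n.
Proof.
move=> D0 cd F n.
have [In|nIn] := boolP ((n%:~R : R) \in I); last first.
  have e : insub n = None :> option V by rewrite insubN.
  by rewrite /line_weight /line_edge /line_fun e /= addr0 ltxx.
move=> _; have := cd (Sub n In) (F \o pos).
(* For K = 0 the lower bound on [Gamma2] is 1/D times a square, hence nonnegative. *)
rewrite Gamma2_line /= mul0r addr0; apply: le_trans.
rewrite mulr_ge0 ?sqr_ge0 // fine_ge0 // inve_ge0; exact: ltW.
Qed.

(** * Graph distance and balls as intervals of integers *)

Lemma line_convex x y (a : int) : pos x <= a <= pos y -> (a%:~R : R) \in I.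
Proof.
have := valP y; have := valP x; rewrite /= -/(pos x) -/(pos y).
case: I (pos x) (pos y) => l u b c; rewrite !itv_boundlr.
move=> /andP[lx _] /andP[_ yu] /andP[xa ay].
apply/andP; split.
  by apply: le_trans lx _; rewrite bnd_simp ler_int.
by apply: le_trans yu; rewrite bnd_simp ler_int.
Qed.

Lemma walk_length_ge x y n : walk_length G x y n -> (`|pos x - pos y| <= n)%N.
Proof.
move=> [p [xp py pn]]; elim: p x n xp py pn => [|z p IH] x [|n] //=.
  by move=> _ ->; rewrite subrr.
rewrite adj_pos => /andP[/orP xz zp] py [pn]; have := IH _ _ zp py pn.
by case: xz => /eqP; lia.
Qed.

Lemma line_walk x y : walk_length G x y `|pos x - pos y|%N.
Proof.
move En : `|pos x - pos y|%N => n.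
elim: n x En => [|n IH] x En; first by exists [::]; split=> //=; apply/pos_inj; lia.
(* One step from [x] towards [y]; it stays between them and therefore in [I]. *)
pose a := if pos x <= pos y then pos x + 1 else pos x - 1.
have aI : (a%:~R : R) \in I.
  rewrite /a; case: ifPn => xy; first by apply: (@line_convex x y); lia.
  by apply: (@line_convex y x); lia.
have za := pos_insubd x aI; move: (insubd x a) za => z za.
have [|p [zp py sp]] := IH z.
  by rewrite za /a; case: ifPn => xy; lia.
exists (z :: p); split => //=; last by rewrite sp.
rewrite zp andbT adj_pos za /a; case: ifPn => xy; apply/orP; [left|right]; lia.
Qed.

Lemma graph_dist_line x y : graph_dist G x y = `|pos x - pos y|%N.
Proof.
rewrite /graph_dist; case: ex_minnP => n /asboolP/walk_length_ge xyn nmin.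
by apply/eqP; rewrite eqn_leq xyn andbT; apply: nmin; apply/asboolP; exact: line_walk.
Qed.

(** A finite list containing the ball. Integers that are not vertices are sent to [x], so entries
    may repeat, which is harmless for an upper bound on the size. *)
Definition ball_enum (r : R) x : seq V :=
  [seq insubd x (pos x - (Num.truncn r)%:Z + i%:Z) |
    i <- iota 0 (Num.truncn r).*2.+1].

Lemma graph_ball_enum r x y : graph_ball G r x y -> y \in ball_enum r x.
Proof.
rewrite /graph_ball /= graph_dist_line => xyr.
have {}xyr : (`|pos x - pos y| <= Num.truncn r)%N.
  by rewrite truncn_ge_nat // (le_trans _ xyr).
apply/mapP; exists `|(pos y - pos x + (Num.truncn r)%:Z)%R|%N.
  by rewrite mem_iota; lia.
set a : int := (X in insubd x X); have -> : a = pos y by rewrite /a; lia.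
by rewrite insubd_pos.
Qed.

Lemma finite_graph_ball r x : finite_set (graph_ball G r x).
Proof.
by apply: sub_finite_set (finite_seq (ball_enum r x)) => y /graph_ball_enum.
Qed.

Lemma size_graph_ball r x :
  (size (fset_set (graph_ball G r x)) <= (Num.truncn r).*2.+1)%N.
Proof.
have <- : size (ball_enum r x) = (Num.truncn r).*2.+1 by rewrite size_map size_iota.
apply: uniq_leq_size => [|y]; first exact: fset_uniq.
by rewrite in_fset_set => [/set_mem/graph_ball_enum|]; last exact: finite_graph_ball.
Qed.

(** * The Poincaré inequality on balls *)

Lemma segment_poincare (D : \bar R) (A B : set V) f x1 x :
  (0 < D)%E -> CD G 0 D -> finite_set B -> A `<=` B ->
  (forall y z (a : int), A y -> A z -> pos y <= a <= pos z ->
     exists2 u, A u & pos u = a) ->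
  A x1 -> (forall z, A z -> m z <= m x1) -> A x ->
  m x * (f x - f x1) ^+ 2 <=
  4 * `|pos x - pos x1|%N%:R *
    \sum_(p \in B `*` B) w p.1 p.2 * (f p.1 - f p.2) ^+ 2.
Proof.
move=> D0 cd finB AB convA Ax1 m_max Ax.
pose s : int := if pos x1 <= pos x then 1 else -1.
have ds : direction s by rewrite /s; case: ifP; [left|right].
set k := `|_|%N.
have sE i : s *+ i = s * i%:Z by rewrite -mulr_natr natz.
have kE : pos x1 + s *+ k = pos x by rewrite sE /s /k; case: ifP; lia.
pose v i := insubd x1 (pos x1 + s *+ i).
have vP i : (i <= k)%N -> A (v i) /\ pos (v i) = pos x1 + s *+ i.
  move=> ik; suff [u Au ua] : exists2 u, A u & pos u = pos x1 + s *+ i.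
    by rewrite /v -ua insubd_pos.
  move: ik; rewrite sE /s /k; case: ifP => x1x ik.
    by apply: (convA x1 x) => //; lia.
  by apply: (convA x x1) => //; lia.
(* Distinct vertices make the pairs ([v i], [v i.+1]) distinct, so the segment sum is a subsum of
   the energy on [B]. *)
have v_inj i j : (i <= k)%N -> (j <= k)%N -> v i = v j -> i = j.
  move=> /vP[_ vi] /vP[_ vj] vij; move: vi; rewrite vij vj !sE.
  by case: ds => ->; lia.
have v_adj i : (i < k)%N -> adj G (v i) (v i.+1).
  move=> ik; have [_ vi] := vP _ (ltnW ik); have [_ vj] := vP _ ik.
  by rewrite adj_pos vi vj !sE; case: ds => ->; lia.
(* For [k] = 0 there is no vertex [v 1] in [A] to compare with the maximum at [x1]. *)
have [k0|k_gt0] := posnP k.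
  move: kE; rewrite k0 mulr0n addr0 mulr0 mul0r => /pos_inj ->.
  by rewrite subrr expr0n mulr0.
have := @line_poincare R line_edge line_edge_ge0 line_edge_sym
  (line_Gamma2_ge0 D0 cd) (line_fun f) (pos x1) s k ds.
rewrite kE !line_fun_val -!vertex_weight_line => /(_ _ _)/le_trans; apply.
- by move=> i ik; have [_ <-] := vP _ (ltnW ik); have [_ <-] := vP _ ik;
  rewrite line_edge_val edge_weight_gt0 // v_adj.
- have [Av1] := vP _ k_gt0; rewrite mulr1n => <-.
  by rewrite -!vertex_weight_line m_max.
rewrite ler_wpM2l ?mulr_ge0 ?ler0n //.
rewrite fsbig_finite /=; last exact: finite_setX.
pose T (p : V * V) := w p.1 p.2 * (f p.1 - f p.2) ^+ 2.
rewrite (eq_bigr (fun i : 'I_k => T (v i, v i.+1))); last first.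
  move=> [i ik] _ /=; have [_ <-] := vP _ (ltnW ik); have [_ <-] := vP _ ik.
  by rewrite line_edge_val !line_fun_val.
rewrite -(big_mkord xpredT (fun i => T (v i, v i.+1))).
rewrite -(big_map (fun i => (v i, v i.+1)) xpredT T).
apply: ler_sum_subseq.
- exact: fset_uniq.
- rewrite map_inj_in_uniq ?iota_uniq // => i j; rewrite !mem_index_iota.
  move=> /= ik jk [+ _].
  by apply: v_inj; exact: ltnW.
- move=> p /mapP[i]; rewrite mem_index_iota => /= ik ->.
  rewrite in_fset_set; last exact: finite_setX.
  by apply/mem_set; split; apply: AB;
    have [] := vP _ (ltnW ik); have [] := vP _ ik.
- by move=> p; rewrite mulr_ge0 ?sqr_ge0 // edge_weight_ge0.
Qed.

Lemma graph_ball_convex r x0 y z (a : int) :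
  graph_ball G r x0 y -> graph_ball G r x0 z -> pos y <= a <= pos z ->
  exists2 u, graph_ball G r x0 u & pos u = a.
Proof.
rewrite /graph_ball /= !graph_dist_line => yr zr yaz.
have ua := pos_insubd x0 (line_convex yaz).
exists (insubd x0 a) => //; rewrite graph_dist_line ua.
(* A point between two others is no farther from the centre than the farther of them. *)
have [le_d|le_d] : (`|pos x0 - a| <= `|pos x0 - pos y|)%N \/
                   (`|pos x0 - a| <= `|pos x0 - pos z|)%N by lia.
  by apply: le_trans yr; rewrite ler_nat.
by apply: le_trans zr; rewrite ler_nat.
Qed.

Lemma graph_ball_center r x : 0 <= r -> graph_ball G r x x.
Proof. by rewrite /graph_ball /= graph_dist_line subrr. Qed.

Lemma graph_ball_diam r x0 x y : graph_ball G r x0 x -> graph_ball G r x0 y ->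
  `|pos x - pos y|%N%:R <= 2 * r.
Proof.
rewrite /graph_ball /= !graph_dist_line => xr yr.
apply: (@le_trans _ _ (`|pos x0 - pos x| + `|pos x0 - pos y|)%N%:R).
  by rewrite ler_nat; lia.
by rewrite natrD; lra.
Qed.

Lemma linear_poincare (D : \bar R) : (0 < D)%E -> CD G 0 D -> poincare G 16.
Proof.
move=> D0 cd x0 r f r0.
set A := graph_ball G r x0; set B := graph_ball G (2 * r) x0.
set S := \sum_(p \in B `*` B) _.
have finA : finite_set A by exact: finite_graph_ball.
have finB : finite_set B by exact: finite_graph_ball.
have AB : A `<=` B by move=> y /= yr; apply: le_trans yr _; lra.
have memA y : y \in fset_set A <-> A y.
  by rewrite in_fset_set //; split=> [/set_mem|/mem_set].
have [|x1 /memA Ax1 m_max] := @seq_argmax _ _ m x0 (fset_set A).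
  by apply/memA; apply: graph_ball_center; exact: ltW.
have {}m_max z : A z -> m z <= m x1 by move=> /memA; exact: m_max.
have S0 : 0 <= S.
  rewrite /S fsbig_finite; last exact: finite_setX.
  by apply: sumr_ge0 => p _; rewrite mulr_ge0 ?sqr_ge0 // edge_weight_ge0.
have x1s : x1 \in (fset_set A : seq V) by exact/memA.
rewrite /ball_average /graph_measure !fsbig_finite //=.
apply: le_trans (variance_le _ (f x1) _) _.
  rewrite (big_rem x1) //= ltr_wpDr ?vertex_weight_gt0 //.
  by apply: sumr_ge0 => z _; exact/ltW/vertex_weight_gt0.
rewrite (big_rem x1) //= subrr expr0n mulr0 add0r.
(* The diameter bound 2 r turns the segment factor 4 |z - x1| into 8 r. *)
apply: (@le_trans _ _ (\sum_(z <- rem x1 (fset_set A)) 8 * r * S)).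
  rewrite big_seq [leRHS]big_seq; apply: ler_sum => z /mem_rem/memA Az.
  apply: le_trans (segment_poincare f D0 cd finB AB _ Ax1 m_max Az) _.
    exact: graph_ball_convex.
  rewrite ler_wpM2r //; have := graph_ball_diam Az Ax1; lra.
rewrite big_const_seq count_predT iter_addr_0 size_rem //.
(* Dropping [x1] lowers the count 2 floor(r) + 1 to 2 floor(r), which is at most 2 r even for small
   [r]; 8 r times 2 r gives the constant 16. *)
have size_le : (size (fset_set A)).-1%:R <= 2 * r.
  apply: (@le_trans _ _ ((Num.truncn r).*2)%:R).
    by rewrite ler_nat; have := size_graph_ball r x0; rewrite -/A; lia.
  by rewrite -mul2n natrM ler_wpM2l // truncn_le ltW.
rewrite -[leLHS]mulr_natr.
apply: (@le_trans _ _ (8 * r * S * (2 * r))).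
  by rewrite ler_wpM2l // !mulr_ge0 // ltW.
by rewrite le_eqVlt; apply/orP; left; apply/eqP; ring.
Qed.

End LinearGraph.

Theorem theorem1p13 (R : realType) (I : interval R)
    (G : weightedGraph R {n : int | n%:~R \in I}) (D : \bar R) :
  linear_graph G ->
  infinite_set [set: {n : int | n%:~R \in I}] ->
  normalized G ->
  (0 < D)%E -> (D < +oo)%E ->
  CD G 0 D ->
  poincare G 16.
Proof.
by move=> linG _ normG D0 _ cd; exact: (linear_poincare linG normG D0 cd).
Qed.
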